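(* For every integer $n\ge 1$, $$GM_{n+1}GM_{n-1}-GM_n^2=(2^{n-2}-2^{n-1})-i\,(3\cdot 2^{n-2}).$$
   Context: The Gaussian Mersenne sequence $(GM_k)_{k\ge 0}$ of complex numbers is defined by $GM_0=-\frac{i}{2}$, $GM_1=1$ and $GM_{k+2}=3GM_{k+1}-2GM_k$ for $k\ge 0$, where $i$ is the imaginary unit. *)

(* Defs.v *)
From HB Require Import structures.
From mathcomp Require Import all_boot all_order all_algebra.
From mathcomp Require Import complex.
From mathcomp Require Import reals.

Set Implicit Arguments.
Unset Strict Implicit.
Unset Printing Implicit Defensive.

Import Order.TTheory GRing.Theory Num.Theory.

Local Open Scope ring_scope.
Local Open Scope complex_scope.

(* [R[i]], for [R : realType], is the field of complex numbers over the real
   field [R], and ['i%C] is its imaginary unit [0 +i* 1]. *)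
Fixpoint GM (R : realType) (k : nat) : R[i] :=
  match k with
  | 0%N => - 'i%C / 2
  | 1%N => 1
  | (k'.+1 as k1).+1 => 3 * GM R k1 - 2 * GM R k'
  end.

Arguments GM R k : clear implicits.

(* Main.v *)
Require Import Defs.
From mathcomp Require Import all_boot all_order all_algebra.
From mathcomp Require Import complex.
From mathcomp Require Import reals.
From mathcomp Require Import ring.

Import Order.TTheory GRing.Theory Num.Theory.
Local Open Scope ring_scope.
Local Open Scope complex_scope.

(** The left-hand side is the Casoratian
    [D k = u (k + 2) * u k - u (k + 1) ^ 2] of a sequence obeying a
    second-order linear recurrence [u (k + 2) = a * u (k + 1) - b * u k].
    It is the determinant of two consecutive state vectors, and one step of
    the recurrence acts on those vectors by a matrix of determinant [b], so
    [D k = b ^ k * D 0] ([cassini_linear_recurrence]).  For the Gaussian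
    Mersenne numbers [b = 2], and [D 0 = (3 + i) (- i / 2) - 1 = - (1 + 3 i) / 2]
    ([GM_cassini0]); the right-hand side of the theorem is this constant
    times [2 ^ (n - 1)]. *)

(** Since [u k.+3 = a * u k.+2 - b * u k.+1] and
    [a * u k.+1 - u k.+2 = b * u k], each Casoratian is [b] times the previous
    one, so the values at [0], [1] and [2] determine all of them. *)
Lemma cassini_linear_recurrence (A : comPzRingType) (a b : A) (u : nat -> A) :
    (forall k, u k.+2 = a * u k.+1 - b * u k) ->
  forall k, u k.+2 * u k - u k.+1 ^+ 2 = b ^+ k * (u 2 * u 0 - u 1 ^+ 2).
Proof.
move=> rec; elim=> [|k IHk]; first by rewrite expr0 mul1r.
by rewrite [b ^+ _]exprS -mulrA -IHk !rec; ring.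
Qed.

Lemma GM_cassini0 (R : realType) :
  GM R 2 * GM R 0 - GM R 1 ^+ 2 = - (1 + 3 * 'i%C) / 2.
Proof.
have i2 : ('i%C : R[i]) ^+ 2 = - 1 by rewrite sqr_i.
by rewrite /=; field: i2.
Qed.

Theorem theorem3p3 (R : realType) (n : nat) (hn : (1 <= n)%N) :
  GM R n.+1 * GM R n.-1 - GM R n ^+ 2 =
  ((2 : R[i]) ^ (n%:Z - 2) - (2 : R[i]) ^ (n%:Z - 1))
    - 'i%C * (3 * (2 : R[i]) ^ (n%:Z - 2)).
Proof.
case: n hn => // k _.
have two_neq0 : (2 : R[i]) != 0 by rewrite pnatr_eq0.
have -> : (2 : R[i]) ^ (k.+1%:Z - 1) = 2 ^+ k.
  by rewrite intS addrC addKr.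
(* For [k = 0] the exponent is negative, hence the division by 2. *)
have -> : (2 : R[i]) ^ (k.+1%:Z - 2) = 2 ^+ k / 2.
  have -> : k.+1%:Z - 2 = k%:Z + (-1) by rewrite intS; ring.
  by rewrite expfzDr.
rewrite (cassini_linear_recurrence _ 3 2 (GM R)) // GM_cassini0.
by field.
Qed.
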